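(* Let $R=k[x_1,\ldots,x_n]$ be a standard graded polynomial ring in $n\geq 3$ variables over a field $k$. Let $J\subset R$ be a non-perfect homogeneous ideal of height $2$ generated by three forms of degree $d$. Let $$0\to F_{\rho}\to \cdots \to F_2 \to \bigoplus_{i=1}^{m} R(-d-\delta_i)\to R(-d)^3\to R$$ be the minimal graded free resolution associated with $J$ (so that the image of the last map is $J$), where $\rho\ge 2$ is the homological dimension of $J$, $F_2,\ldots,F_\rho$ are graded free modules, $m\ge 3$, and $\delta_1\le\delta_2\le\delta_3\le\cdots\le\delta_m$. Then $\delta_3\leq d$.
   Context: The integer $d\ge 1$ is the common degree of the three generators. A homogeneous ideal $J$ of height $2$ is perfect if $R/J$ has projective dimension $2$ (equivalently, $R/J$ is Cohen--Macaulay); non-perfect means that $J$ has homological (projective) dimension at least $2$ as an $R$-module. The integers $\delta_1\le\cdots\le\delta_m$ are thus the (standard) degrees of a minimal set of generators of the first syzygy module of the three generating forms. *)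

(* Defs.v *)
From HB Require Import structures.
From mathcomp Require Import all_boot all_order all_algebra.
From mathcomp Require Export ring_quotient.
From mathcomp.multinomials Require Export mpoly.

Set Implicit Arguments.
Unset Strict Implicit.
Unset Printing Implicit Defensive.

Import Order.TTheory GRing.Theory Num.Theory.
Local Open Scope ring_scope.

(* [idealr R] and [prime_idealr R] are MathComp's proper and prime ideals, given
   as [{pred R}]; classically every proper (resp. prime) ideal is of this form. *)

Section Height.
Variable R : comNzRingType.

(* C 0 < C 1 < ... < C l = P, a strict chain of primes of length l. *)
Definition prime_chain (P : prime_idealr R) (l : nat)
    (C : nat -> prime_idealr R) : Prop :=
  (forall i, (i < l)%N ->
     {subset C i <= C i.+1} /\ ~ {subset C i.+1 <= C i})
  /\ C l =i P.

Definition prime_height_ge (P : prime_idealr R) (h : nat) : Prop :=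
  exists l C, (h <= l)%N /\ prime_chain P l C.

(* The minimum of the heights of the primes containing J is h. *)
Definition has_height (J : idealr R) (h : nat) : Prop :=
  (forall P : prime_idealr R, {subset J <= P} -> prime_height_ge P h)
  /\ (exists P : prime_idealr R,
        {subset J <= P} /\ ~ prime_height_ge P h.+1).

End Height.

Section ProjectiveDimension.
Variable R : comNzRingType.

Definition projective (P : lmodType R) : Prop :=
  forall (M N : lmodType R) (g : {linear M -> N}) (f : {linear P -> N}),
    (forall y, exists x, g x = y) ->
    exists h : {linear P -> M}, forall x, g (h x) = f x.

(* A projective resolution 0 -> P p -> ... -> P 0 -> M -> 0. *)
Definition proj_dim_le (M : lmodType R) (p : nat) : Prop :=
  exists (P : nat -> lmodType R) (phi : forall i, {linear P i.+1 -> P i})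
         (eps : {linear P 0%N -> M}),
  [/\ forall i, projective (P i),
      forall i, (p < i)%N -> forall x : P i, x = 0,
      forall y, exists x, eps x = y,
      forall x, eps x = 0 <-> exists y, x = phi 0%N y
    & forall i x, phi i x = 0 <-> exists y, x = phi i.+1 y].

Definition has_proj_dim (M : lmodType R) (p : nat) : Prop :=
  proj_dim_le M p /\ (forall q, proj_dim_le M q -> (p <= q)%N).

End ProjectiveDimension.

Section IdealModules.
Variables (R : comNzRingType) (J : idealr R).

Definition ideal_module : Type := {x : R | x \in J}.
HB.instance Definition _ := SubType.on ideal_module.
HB.instance Definition _ := [Choice of ideal_module by <:].
HB.instance Definition _ := [SubChoice_isSubZmodule of ideal_module by <:].

Definition ideal_scale (a : R) (x : ideal_module) : ideal_module :=
  Sub (a * val x) (idealMr a (valP x)).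

Fact ideal_scaleA a b x :
  ideal_scale a (ideal_scale b x) = ideal_scale (a * b) x.
Proof. by apply: val_inj; rewrite !SubK mulrA. Qed.
Fact ideal_scale1 : left_id 1 ideal_scale.
Proof. by move=> x; apply: val_inj; rewrite !SubK mul1r. Qed.
Fact ideal_scaleDr : right_distributive ideal_scale +%R.
Proof. by move=> a x y; apply: val_inj; rewrite /= mulrDr. Qed.
Fact ideal_scaleDl x : {morph ideal_scale^~ x : a b / a + b}.
Proof. by move=> a b; apply: val_inj; rewrite /= mulrDl. Qed.
HB.instance Definition _ := GRing.Zmodule_isLmodule.Build R ideal_module
  ideal_scaleA ideal_scale1 ideal_scaleDr ideal_scaleDl.

Definition quot_module : Type := {ideal_quot J}.
HB.instance Definition _ := GRing.Zmodule.on quot_module.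

Definition quot_scale (a : R) (x : quot_module) : quot_module :=
  (\pi_{ideal_quot J} a * (x : {ideal_quot J}))%qT.

Fact quot_scaleA a b x : quot_scale a (quot_scale b x) = quot_scale (a * b) x.
Proof. by rewrite /quot_scale rmorphM mulrA. Qed.
Fact quot_scale1 : left_id 1 quot_scale.
Proof. by move=> x; rewrite /quot_scale rmorph1 mul1r. Qed.
Fact quot_scaleDr : right_distributive quot_scale +%R.
Proof. by move=> a x y; rewrite /quot_scale mulrDr. Qed.
Fact quot_scaleDl x : {morph quot_scale^~ x : a b / a + b}.
Proof. by move=> a b; rewrite /quot_scale rmorphD mulrDl. Qed.
HB.instance Definition _ := GRing.Zmodule_isLmodule.Build R quot_module
  quot_scaleA quot_scale1 quot_scaleDr quot_scaleDl.

Definition perfect : Prop :=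
  exists h, has_height J h /\ has_proj_dim quot_module h.

Definition generated_by (r : nat) (f : 'I_r -> R) : Prop :=
  forall p, p \in J <-> exists c : 'I_r -> R, p = \sum_(i < r) c i * f i.

End IdealModules.

Section Graded.
Variables (k : fieldType) (n : nat).
Local Notation R := {mpoly k[n]}.

Definition homogeneous_ideal (J : idealr R) : Prop :=
  forall p, p \in J -> forall e, pihomog mdeg e p \in J.

(* p is homogeneous of degree z; only 0 is homogeneous of negative degree. *)
Definition is_form (z : int) (p : R) : bool :=
  match z with
  | Posz e => p \is e.-homog
  | Negz _ => p == 0
  end.

(* The i-th module is F_i = \bigoplus_(j < size (twist i)) R(- (twist i)`_j),
   whose j-th basis vector sits in degree (twist i)`_j.  Elements of F_i are row
   vectors, on which the maps F_(i+1) -> F_i and F_0 -> R act by right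
   multiplication by [phi i] and [aug]. *)
Record minimal_graded_free_resolution (J : idealr R) (twist : nat -> seq int)
    (aug : 'cV[R]_(size (twist 0%N)))
    (phi : forall i, 'M[R]_(size (twist i.+1), size (twist i))) : Prop := {
  mgfr_aug_degree : forall j : 'I_(size (twist 0%N)),
    is_form (twist 0%N)`_j (aug j 0);
  mgfr_degree : forall i (j : 'I_(size (twist i.+1))) (l : 'I_(size (twist i))),
    is_form ((twist i.+1)`_j - (twist i)`_l) (phi i j l);
  mgfr_image : forall p, p \in J <-> exists u : 'rV_ _, p = (u *m aug) 0 0;
  mgfr_exact0 : forall u : 'rV_ _,
    u *m aug = 0 <-> exists v : 'rV_ _, u = v *m phi 0%N;
  mgfr_exact : forall i (u : 'rV_ _),
    u *m phi i = 0 <-> exists v : 'rV_ _, u = v *m phi i.+1;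
  (* every entry lies in the maximal ideal (x_1, ..., x_n) *)
  mgfr_minimal : forall i j l, (phi i j l)@_0%MM = 0
}.

End Graded.

(* Main.v *)
From HB Require Import structures.
Require Import Defs.
From mathcomp Require Import all_boot all_order all_algebra.
From mathcomp Require Import ring.
From Stdlib Require Import Classical ClassicalEpsilon.

Set Implicit Arguments.
Unset Strict Implicit.
Unset Printing Implicit Defensive.

Import Order.TTheory GRing.Theory Num.Theory.
Local Open Scope ring_scope.

(** Suppose [delta_3 > d].  The Koszul relations [f_i e_j - f_j e_i] between the
    three forms have degree [d], so in terms of the minimal generators of the
    syzygy module they only involve the two generators [s] and [t] of lowest
    degree.  It follows that [s] and [t] generate every syzygy.  Indeed, if
    [u] is a syzygy, then [f_i u] is the combination of the Koszul relations with
    coefficients [u_j], hence [f_i u = a_i s + b_i t].  Since [s] and [t] are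
    linearly independent (three forms have two independent Koszul relations),
    comparing [f_j (f_i u)] with [f_i (f_j u)] gives [a_i f_j = a_j f_i], and
    likewise for [b].  The ideal [J] has grade two, so the families [a] and [b] are
    multiples of the family [f], say [a_i = x f_i] and [b_i = y f_i], and
    [u = x s + y t].  In particular the third generator is a combination of the first two, contrary to
    the minimality of the resolution.  These steps are
    [koszul_span_free], [koszul_span_syzygies] and [degree_third_generator].

    Grade two comes from height two as follows ([height2_grade2]).  The polynomial
    ring is factorial ([factorial_mpoly], by Gauss's lemma and induction on the
    number of variables), and in a factorial domain a nonzero principal prime has
    height one ([principal_prime_height]).  Thus no prime element divides all the
    [f_i].  If [a_i f_j = a_j f_i] for all [i, j], each prime factor of [f_i] fails
    to divide some [f_j], so it divides [a_i] and can be cancelled; finally [f_i]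
    divides [a_i], and the quotient is the same for all [i]. *)

(** * Factorial domains *)

Section Factorial.
Variable A : idomainType.
Implicit Types a b c p q : A.

Definition divides a b : Prop := exists c, b = c * a.

Definition prime_elt p : Prop :=
  [/\ p != 0, p \isn't a GRing.unit
    & forall a b, divides p (a * b) -> divides p a \/ divides p b].

(** Products of a unit and of finitely many primes, presented so that induction
    peels off one prime at a time. *)
Inductive prime_product : A -> Prop :=
| prime_product_unit u : u \is a GRing.unit -> prime_product u
| prime_product_mul p a : prime_elt p -> prime_product a -> prime_product (p * a).

Definition factorial_domain : Prop := forall a, a != 0 -> prime_product a.

Lemma divides_trans b a c : divides a b -> divides b c -> divides a c.
Proof. by move=> [x ->] [y ->]; exists (y * x); rewrite mulrA. Qed.

Lemma divides_mull a b : divides a (b * a).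
Proof. by exists b. Qed.

Lemma divides_mulr a b : divides a (a * b).
Proof. by exists b; rewrite mulrC. Qed.

Lemma dividesD a b c : divides a b -> divides a c -> divides a (b + c).
Proof. by move=> [x ->] [y ->]; exists (x + y); rewrite mulrDl. Qed.

Lemma divides_addl a b c : divides a (b + c) -> divides a c -> divides a b.
Proof. by move=> [x e] [y ec]; exists (x - y); rewrite mulrBl -e -ec addrK. Qed.

Lemma divides_mulrr a b c : divides a b -> divides a (b * c).
Proof. by move=> [x ->]; exists (x * c); rewrite mulrAC. Qed.

Lemma prime_productM a b :
  prime_product a -> prime_product b -> prime_product (a * b).
Proof.
elim=> [u uU|p c pP _ IH] bP; last by rewrite -mulrA; apply: prime_product_mul; auto.
elim: bP => [v vU|q c qP _ IH]; first by apply: prime_product_unit; rewrite unitrM uU.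
by rewrite mulrCA; apply: prime_product_mul.
Qed.

(** A prime factor [p] of [g] does not divide some [f j], so by primality the
    equation [b * f j = c * g] makes [p] divide [b]; cancelling the prime factors
    of [g] one by one leaves a unit.  This is how a family without common prime
    divisor has grade two. *)
Lemma coprime_family_divides (I : Type) (f : I -> A) g b :
  prime_product g -> g != 0 ->
  (forall p, prime_elt p -> divides p g -> exists j, ~ divides p (f j)) ->
  (forall j, divides g (b * f j)) -> divides g b.
Proof.
move=> gP; elim: gP b => {g} [u uU|p g pP _ IH] b g0 cop dv.
  by exists (b * u^-1); rewrite divrK.
have [p0 _ pprime] := pP.
have [j ndj] := cop p pP (divides_mulr _ _).
have [b' eb] : divides p b.
  case: (pprime b (f j)) => [|//|/ndj//].
  by apply: divides_trans (dv j); apply: divides_mulr.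
have [||i|c ec] := IH b' _ _.
- by move: g0; rewrite mulf_eq0 negb_or => /andP[].
- by move=> q qP qg; apply: cop qP _; apply: divides_trans qg (divides_mull _ _).
- have [c ec] := dv i; exists c.
  by apply: (mulfI p0); rewrite mulrA [p * b']mulrC -eb ec mulrCA.
by exists c; rewrite eb ec mulrAC -mulrA.
Qed.

Lemma coprime_family_grade2 (I : Type) (f a : I -> A) :
  factorial_domain -> (exists i, f i != 0) ->
  (forall p, prime_elt p -> exists j, ~ divides p (f j)) ->
  (forall i j, a i * f j = a j * f i) -> exists c, forall i, a i = c * f i.
Proof.
move=> fA [i fi0] cop ha.
have [||c ec] := coprime_family_divides (f := f) (b := a i) (fA _ fi0) fi0.
- by move=> p pP _; apply: cop.
- by move=> j; rewrite ha; apply: divides_mull.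
by exists c => j; apply: (mulIf fi0); rewrite -ha ec mulrAC.
Qed.

End Factorial.

Lemma factorial_domain_iso (A B : idomainType) (f : {rmorphism A -> B})
    (g : {rmorphism B -> A}) :
  cancel f g -> cancel g f -> factorial_domain A -> factorial_domain B.
Proof.
move=> fK gK fA.
have dvf x y : divides x y -> divides (f x) (f y).
  by move=> [c ->]; exists (f c); rewrite rmorphM.
have dvg x y : divides x y -> divides (g x) (g y).
  by move=> [c ->]; exists (g c); rewrite rmorphM.
have fprime p : prime_elt p -> prime_elt (f p).
  move=> [p0 pU pP]; split.
  - by apply: contra_neq p0 => fp0; rewrite -[p]fK fp0 rmorph0.
  - by apply: contra pU => /(rmorph_unit g); rewrite fK.
  move=> a b /dvg; rewrite fK rmorphM => /pP[] /dvf; rewrite gK; auto.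
have fpp a : prime_product a -> prime_product (f a).
  elim=> [u uU|p c pP _ IH]; first by apply: prime_product_unit; apply: rmorph_unit.
  by rewrite rmorphM; apply: prime_product_mul => //; apply: fprime.
move=> b b0; rewrite -[b]gK; apply/fpp/fA.
by apply: contra_neq b0 => gb0; rewrite -[b]gK gb0 rmorph0.
Qed.

(** * Gauss's theorem *)

Section Gauss.
Variable A : idomainType.
Hypothesis fA : factorial_domain A.
Implicit Types (c p : A) (f g h : {poly A}).

(** Content one, without a gcd of the coefficients. *)
Definition primitive f : Prop :=
  f != 0 /\ forall c, divides c%:P f -> c \is a GRing.unit.

Lemma primitive_divides f g : primitive f -> divides g f -> primitive g.
Proof.
move=> [f0 fP] gf; split; last by move=> c cg; apply/fP/(divides_trans cg gf).
by apply: contraNneq f0 => g0; case: gf => q ->; rewrite g0 mulr0.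
Qed.

Lemma divides_mulX p f : p != 0 -> divides p%:P (f * 'X) -> divides p%:P f.
Proof.
have X0 : 'X != 0 :> {poly A} by rewrite polyX_eq0.
move=> p0 [q]; elim/poly_ind: q => [|q e _] eq.
  exists 0; apply: (mulIf X0).
  by rewrite eq !mul0r.
have := congr1 (fun h => h`_0) eq; rewrite coefMX eqxx coefMC.
rewrite coefD coefMX coefC !eqxx add0r => /esym/eqP.
rewrite mulf_eq0 (negbTE p0) orbF => /eqP e0.
by exists q; apply: (mulIf X0); rewrite eq e0 addr0 mulrAC.
Qed.

Lemma divides_polyC p c : divides p c -> divides p%:P c%:P.
Proof. by move=> [e ->]; exists e%:P; rewrite polyCM. Qed.

(** If [p] divides the product of [f * 'X + c%:P] and [g * 'X + e%:P], it divides
    [c * e]; the constant term that it divides can be removed, which lowers the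
    degree of one factor. *)
Lemma prime_polyC p : prime_elt p -> prime_elt p%:P.
Proof.
move=> [p0 pU pP]; split; first by rewrite polyC_eq0.
  by apply: contra pU; rewrite poly_unitE coefC size_polyC p0.
move=> f; elim/poly_ind: f => [|f c IHf] g.
  by move=> _; left; exists 0; rewrite mul0r.
elim/poly_ind: g => [|g e IHg] dv; first by right; exists 0; rewrite mul0r.
have [|pc|pe] := pP c e.
- case: dv => q /(congr1 (fun h => h`_0)).
  rewrite coefMC coef0M !coefD !coefMX !coefC !eqxx !add0r => ->.
  exact: divides_mull.
- have [|pf|] := IHf (g * 'X + e%:P); last by right.
    apply: divides_mulX => //; rewrite mulrAC.
    apply: (divides_addl (c := c%:P * (g * 'X + e%:P))); first by rewrite -mulrDl.
    exact/divides_mulrr/divides_polyC.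
  by left; apply: dividesD; [exact: divides_mulrr | exact: divides_polyC].
have [||pg] := IHg; first 1 last.
- by left.
- by right; apply: dividesD; [exact: divides_mulrr | exact: divides_polyC].
apply: divides_mulX => //; rewrite -mulrA.
apply: (divides_addl (c := (f * 'X + c%:P) * e%:P)); first by rewrite -mulrDr.
by rewrite mulrC; exact/divides_mulrr/divides_polyC.
Qed.

(** The constants dividing [f] all divide its leading coefficient; dividing out
    the primes of the latter, as long as they divide [f], terminates. *)
Lemma primitive_part f :
  f != 0 -> exists c g, [/\ c != 0, primitive g & f = c *: g].
Proof.
move=> f0.
have bound c : divides c%:P f -> divides c (lead_coef f).
  by move=> [q ->]; exists (lead_coef q); rewrite lead_coefM lead_coefC.
have : prime_product (lead_coef f) by apply: fA; rewrite lead_coef_eq0.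
move: (lead_coef f) bound => l bound lP.
elim: lP f f0 bound => [u uU|p a pP aP IH] f f0 bound.
  exists 1, f; rewrite oner_neq0 scale1r; split=> //; split=> // c /bound[x ux].
  by move: uU; rewrite ux unitrM => /andP[].
have [p0 pU pprime] := pP.
have [[h eh]|npf] := classic (divides p%:P f).
  have h0 : h != 0 by apply: contraNneq f0 => h0; rewrite eh h0 mul0r.
  have [c [x xh]|c [g [c0 gP eg]]] := IH h h0 _.
    have [|y ey] := bound (p * c).
      by exists x; rewrite eh xh polyCM -mulrA [c%:P * _]mulrC.
    by exists y; apply: (mulfI p0); rewrite ey mulrCA.
  exists (p * c), g; split=> //; first exact: mulf_neq0.
  by rewrite eh eg -scalerA -[in RHS]mul_polyC mulrC.
apply: IH => // c cf; have [x ex] := bound c cf.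
have [|[y ey]|[y ey]] := pprime x c; first by rewrite -ex; apply: divides_mulr.
  by exists y; apply: (mulfI p0); rewrite ex ey [y * p]mulrC mulrA.
by case: npf; apply: divides_trans cf; exists y%:P; rewrite ey polyCM.
Qed.

(** Gauss's lemma: the primes of a denominator [c] in [c *: g = q * f] are primes
    of the polynomial ring not dividing [f], hence can be cancelled from [q]. *)
Lemma primitive_dvdp f g : primitive f -> Pdiv.Idomain.dvdp f g -> divides f g.
Proof.
move=> [f0 fP] /Pdiv.Idomain.dvdpP[[c q] /= c0 e].
elim: (fA c0) q e => [u uU|p a pP _ IH] q e.
  by exists (u^-1 *: q); rewrite -scalerAl -e scalerA mulVr // scale1r.
have [p0 pU _] := pP; have [_ _ pprime] := prime_polyC pP.
have [|[q' eq]|pf] := pprime q f.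
- by rewrite -e -scalerA -mul_polyC; apply: divides_mulr.
- apply: (IH q'); apply: (mulfI (x := p%:P)); first by rewrite polyC_eq0.
  by rewrite mul_polyC scalerA e eq mulrCA mulrA.
by move: pU; rewrite fP.
Qed.

(** Over the field of fractions, [r = gcdp f a] is associate to a primitive
    polynomial that divides [f].  Irreducibility leaves two cases: [r] is
    constant, and [f] divides [b] because it is coprime to [a]; or [r] is
    associate to [f], which then divides [a]. *)
Lemma primitive_irreducible_prime f :
  primitive f -> (1 < size f)%N ->
  (forall g h, f = g * h -> (size g < size f)%N -> (size h < size f)%N -> False) ->
  prime_elt f.
Proof.
move=> fP f1 irr; have f0 := fP.1; split=> //.
  by rewrite poly_unitE; apply/negP => /andP[/eqP ef]; rewrite ef in f1.
move=> a b [q ab].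
have fab : Pdiv.Idomain.dvdp f (a * b) by rewrite ab dvdp_mull.
pose r := Pdiv.Idomain.gcdp f a.
have r0 : r != 0 by rewrite gcdp_eq0 (negbTE f0).
have [c [r' [c0 r'P er]]] := primitive_part r0.
have sr : size r = size r' by rewrite er size_scale.
have rf : Pdiv.Idomain.dvdp r f by apply: dvdp_gcdl.
have [h eh] : divides r' f.
  by apply: primitive_dvdp => //; move: rf; rewrite er dvdpZl.
have h0 : h != 0 by apply: contraNneq f0 => h0; rewrite eh h0 mul0r.
have szf : size f = (size h + size r').-1 by rewrite {1}eh size_mul ?r'P.1.
have szh : (0 < size h)%N by rewrite size_poly_gt0.
have szr : (0 < size r')%N by rewrite size_poly_gt0 r'P.1.
have [r1|rn1] := eqVneq (size r') 1%N.
  right; apply: primitive_dvdp => //.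
  have cfa : coprimep f a by rewrite coprimep_def -/r sr r1.
  by rewrite -(Gauss_dvdpr _ cfa).
have [h1|hn1] := eqVneq (size h) 1%N.
  left; apply: primitive_dvdp => //.
  have : eqp r f by rewrite -(dvdp_size_eqp rf) sr szf h1.
  by rewrite eqp_sym => /andP[frr _]; apply: dvdp_trans frr (dvdp_gcdr _ _).
case: (irr h r' eh); rewrite szf.
  by case: (size r') szr rn1 => [|[|s]] // _ _; rewrite !addnS ltnS leq_addr.
by case: (size h) szh hn1 => [|[|s]] // _ _; rewrite !addSn ltnS leq_addl.
Qed.

(** Factors of a primitive polynomial are primitive, so factoring into polynomials
    of smaller degree until this is impossible ends with primes. *)
Lemma primitive_prime_product f : primitive f -> prime_product f.
Proof.
have [N] := ubnP (size f); elim: N f => // N IH f; rewrite ltnS => sf fP.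
have [f1|f1] := leqP (size f) 1.
  have [f0 cP] := fP; apply: prime_product_unit.
  rewrite [f]size1_polyC //; apply/rmorph_unit/cP.
  by rewrite -size1_polyC //; exists 1; rewrite mul1r.
have [[g [h [e gf hf]]]|irr] := classic
  (exists g h, [/\ f = g * h, (size g < size f)%N & (size h < size f)%N]).
  have gP : primitive g by apply: primitive_divides fP _; rewrite e; apply: divides_mulr.
  have hP : primitive h by apply: primitive_divides fP _; rewrite e; apply: divides_mull.
  by rewrite e; apply: prime_productM; apply: IH => //; apply: leq_trans sf.
rewrite -[f]mulr1; apply: prime_product_mul; last exact/prime_product_unit/unitr1.
by apply: primitive_irreducible_prime => // g h e gf hf; case: irr; exists g, h.
Qed.

Lemma factorial_poly : factorial_domain {poly A}.
Proof.
move=> f /primitive_part[c [g [c0 gP ->]]].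
rewrite -mul_polyC; apply: prime_productM; last exact: primitive_prime_product.
elim: (fA c0) => [u uU|p a pP _ IH].
  by apply: prime_product_unit; apply: rmorph_unit.
by rewrite polyCM; apply: prime_product_mul => //; apply: prime_polyC.
Qed.

End Gauss.

(** * Polynomial rings over a field *)

Section LastVariable.
Variables (k : fieldType) (n : nat).

(** The inverse of [muni]: substitute the last variable for ['X]. *)
Definition of_uni (q : {poly {mpoly k[n]}}) : {mpoly k[n.+1]} :=
  horner_eval 'X_ord_max (map_poly (@mwiden n k) q).

HB.instance Definition _ := GRing.RMorphism.copy of_uni
  (horner_eval ('X_ord_max : {mpoly k[n.+1]}) \o map_poly (@mwiden n k)).

Lemma of_uniC c : of_uni c%:P = mwiden c.
Proof. by rewrite /of_uni map_polyC horner_evalE hornerC. Qed.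

Lemma of_uniX : of_uni 'X = 'X_ord_max.
Proof. by rewrite /of_uni map_polyX horner_evalE hornerX. Qed.

Lemma muniX (m : 'X_{1..n.+1}) :
  muni ('X_[m] : {mpoly k[n.+1]}) =
  'X_[[multinom m (widen_ord (leqnSn n) i) | i < n]] *: 'X^(m ord_max).
Proof. by rewrite muniE msuppX big_seq1 mcoeffX eqxx scale1r. Qed.

Lemma muni_mwiden (c : {mpoly k[n]}) : muni (mwiden c) = c%:P.
Proof.
elim/mpolyind: c => [|a m p _ _ IH]; first by rewrite !raddf0.
rewrite !raddfD /= IH mwidenZ mwidenX muniZ muniX mnmwiden_ordmax expr0.
rewrite -[_ *: 1]mul_polyC mulr1 -!mul_polyC -polyCM mul_mpolyC.
by congr ((_ *: 'X_[_])%:P + _); apply/mnmP => i; rewrite mnmE mnmwiden_widen.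
Qed.

Lemma of_uniK : cancel of_uni (@muni n k).
Proof.
move=> q; elim/poly_ind: q => [|q c IH]; first by rewrite !rmorph0.
rewrite !rmorphD !rmorphM /= IH of_uniX of_uniC muni_mwiden muniX.
congr (_ * _ + _); rewrite mnm1E eqxx.
have -> : [multinom U_(ord_max)%MM (widen_ord (leqnSn n) i) | i < n] = 0%MM.
  by apply/mnmP => i; rewrite !mnmE eqE /= gtn_eqF.
by rewrite mpolyX0 scale1r.
Qed.

Lemma muniK : cancel (@muni n k) of_uni.
Proof.
elim/mpolyind => [|a m p _ _ IH]; first by rewrite !rmorph0.
rewrite !rmorphD /= IH muniZ muniX -!mul_polyC !rmorphM /= !rmorphXn /=.
rewrite of_uniX !of_uniC mwidenC mwidenX mul_mpolyC; congr (_ *: _ + _).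
rewrite (mpolyXE_id _ m) (mpolyXE_id _ (mnmwiden _)) !big_ord_recr /=.
rewrite mnmwiden_ordmax expr0 mulr1; congr (_ * _).
by apply: eq_bigr => i _; rewrite mnmwiden_widen mnmE.
Qed.

End LastVariable.

Lemma factorial_mpoly (k : fieldType) (n : nat) : factorial_domain {mpoly k[n]}.
Proof.
elim: n => [|n IH].
  move=> p p0; apply: prime_product_unit.
  have pE : p = (p@_0)%:MP.
    apply/mpolyP => m; rewrite mcoeffC.
    by have -> : m = 0%MM; [apply/mnmP; case | rewrite eqxx mulr1].
  rewrite pE; apply: rmorph_unit; rewrite unitfE.
  by apply: contraNneq p0 => p00; rewrite pE p00.
exact: factorial_domain_iso (@of_uniK k n) (@muniK k n) (factorial_poly IH).
Qed.

(** * Height two *)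

Section PrincipalPrimes.
Variable A : idomainType.
Hypothesis fA : factorial_domain A.
Variable p : A.
Hypothesis pU : p \isn't a GRing.unit.
Hypothesis pprime : forall a b, divides p (a * b) -> divides p a \/ divides p b.

(** Membership in a [prime_idealr] is boolean, whence the appeal to the informative
    excluded middle. *)
Lemma principal_prime_ideal :
  exists P : prime_idealr A, forall x, x \in P <-> divides p x.
Proof.
pose I : {pred A} :=
  fun x => if excluded_middle_informative (divides p x) then true else false.
have inI x : x \in I <-> divides p x.
  by rewrite unfold_in /I; case: excluded_middle_informative.
have idI : idealr_closed I.
  split; first by apply/inI; exists 0; rewrite mul0r.
    apply/negP => /inI[c c1]; move/negP: pU; apply.
    by apply/unitrPr; exists c; rewrite mulrC.
  by move=> a x y /inI xI /inI yI; apply/inI; rewrite mulrC; apply: dividesD => //; apply: divides_mulrr.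
have prI : prime_idealr_closed I.
  by move=> x y /inI/pprime[] /inI ->; rewrite ?orbT.
by exists (HB.pack_for (prime_idealr A) I
  (isIdealr.Build A I idI) 
  (isPrimeIdealrClosed.Build A I prI)).
Qed.

(** A nonzero prime [Q] inside [(p)] contains a prime factor [q] of any of its
    nonzero elements; [q] is a multiple of [p], hence associate to it, and so [Q]
    is [(p)].  Allowing [p = 0] also covers the zero ideal. *)
Lemma principal_prime_height (P : prime_idealr A) :
  (forall x, x \in P <-> divides p x) -> ~ prime_height_ge P 2.
Proof.
move=> PE [l [C [l2 [Cchain CP]]]].
case: l l2 Cchain CP => [|[|l]] // _ Cchain CP.
have [sub01 nsub10] := Cchain l (ltnW (ltnSn _)).
have [sub12 nsub21] := Cchain l.+1 (ltnSn _).
have notp : p \notin C l.+1.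
  apply/negP => pC; apply: nsub21 => x; rewrite CP => /PE[c ->].
  exact: idealMr.
apply: nsub10 => x xC1; have [->|x0] := eqVneq x 0; first exact: idealr0.
exfalso; elim: (fA x0) xC1 => [u uU uC|q a [q0 qU qprime] _ IH].
  by have := idealMr u^-1 uC; rewrite mulVr // idealr1.
rewrite prime_idealrM => /orP[qC|//].
have [c ec] : divides p q by apply/PE; rewrite -CP; apply: sub12.
have [|[e ee]|[e ee]] := qprime c p; first by rewrite -ec; exists 1; rewrite mul1r.
  move/negP: pU; apply; apply/unitrPr; exists e; apply: (mulfI q0).
  by rewrite mulr1 [RHS]ec ee mulrA mulrC mulrA.
by move/negP: notp; apply; rewrite ee idealMr.
Qed.

End PrincipalPrimes.

Lemma height2_not_in_principal (A : idomainType) (fA : factorial_domain A)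
    (J : idealr A) (r : nat) (f : 'I_r -> A) (p : A) :
  has_height J 2 -> generated_by J f -> p \isn't a GRing.unit ->
  (forall a b, divides p (a * b) -> divides p a \/ divides p b) ->
  exists i, ~ divides p (f i).
Proof.
move=> [ht _] genJ pU pprime; apply: not_all_ex_not => pf.
have [P PE] := principal_prime_ideal pU pprime.
apply: (principal_prime_height fA pU PE); apply: ht => x /genJ[c ->].
apply/PE; apply: big_ind => [|y z|i _]; first by exists 0; rewrite mul0r.
- exact: dividesD.
- by apply: divides_trans (pf i) (divides_mull _ _).
Qed.

(** The case of the zero ideal: the family is not contained in [(0)]. *)
Lemma height2_neq0 (A : idomainType) (J : idealr A) (r : nat) (f : 'I_r -> A) :
  factorial_domain A -> has_height J 2 -> generated_by J f -> exists i, f i != 0.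
Proof.
move=> fA ht genJ.
have div0 (x : A) : divides 0 x <-> x = 0.
  by split=> [[c ->]|->]; [rewrite mulr0 | exists 0; rewrite mul0r].
have [||i fi] := height2_not_in_principal fA (p := 0) ht genJ.
- by rewrite unitr0.
- by move=> x y /div0/eqP; rewrite mulf_eq0 => /orP[] /eqP/div0; auto.
by exists i; apply/eqP => /div0.
Qed.

Lemma height2_grade2 (A : idomainType) (J : idealr A) (r : nat) (f a : 'I_r -> A) :
  factorial_domain A -> has_height J 2 -> generated_by J f ->
  (forall i j, a i * f j = a j * f i) -> exists c, forall i, a i = c * f i.
Proof.
move=> fA ht genJ; apply: coprime_family_grade2 => //.
  exact: height2_neq0 ht genJ.
by move=> p [_ pU pprime]; apply: (height2_not_in_principal fA ht genJ).
Qed.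

(** * Two rows that generate the Koszul relations *)

Section KoszulSpan.
Variables (A : idomainType) (f s t : 'I_3 -> A).

(** The coordinate [l] of the Koszul relation [f_i e_j - f_j e_i]. *)
Definition koszul (i j l : 'I_3) : A := f i *+ (l == j) - f j *+ (l == i).

Hypothesis f_neq0 : exists i, f i != 0.
Hypothesis koszul_span :
  forall i j, exists a b, forall l, koszul i j l = a * s l + b * t l.

Lemma two_others (i : 'I_3) : exists j k, [/\ j != i, k != i & j != k].
Proof.
case: i => [[|[|[|//]]] Hi].
- by exists (Ordinal (isT : 1 < 3)%N), (Ordinal (isT : 2 < 3)%N).
- by exists (Ordinal (isT : 0 < 3)%N), (Ordinal (isT : 2 < 3)%N).
- by exists (Ordinal (isT : 0 < 3)%N), (Ordinal (isT : 1 < 3)%N).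
Qed.

(** If [x s + y t = 0], multiplication by [y] maps the span of [s] and [t] into that of
    [s].  So the relations [koszul i j] and [koszul i k], multiplied by [y], become
    proportional to [s]; but at the positions [j] and [k] they are the rows
    [(f i, 0)] and [(0, f i)], which forces [y * f i = 0].  Symmetrically [x * f i = 0]. *)
Lemma koszul_span_free x y :
  (forall l, x * s l + y * t l = 0) -> x = 0 /\ y = 0.
Proof.
move=> xy0; have [i fi0] := f_neq0; have [j [k [ji ki jk]]] := two_others i.
have [a [b Kj]] := koszul_span i j; have [a' [b' Kk]] := koszul_span i k.
have yK c c' l : y * (c * s l + c' * t l) = (c * y - c' * x) * s l.
  rewrite -[RHS]addr0 -[in RHS](mulr0 c') -(xy0 l); ring.
have xK c c' l : x * (c * s l + c' * t l) = (c' * x - c * y) * t l.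
  rewrite -[RHS]addr0 -[in RHS](mulr0 c) -(xy0 l); ring.
have Kjj : koszul i j j = f i by rewrite /koszul eqxx (negbTE ji) subr0.
have Kkk : koszul i k k = f i by rewrite /koszul eqxx (negbTE ki) subr0.
have Kjk : koszul i j k = 0 by rewrite /koszul eq_sym (negbTE jk) (negbTE ki) subr0.
have Kkj : koszul i k j = 0 by rewrite /koszul (negbTE jk) (negbTE ji) subr0.
have main z D D' (w : 'I_3 -> A) : z * f i = D * w j -> 0 = D * w k ->
    z * f i = D' * w k -> z = 0.
  move=> e1 /esym/eqP; rewrite mulf_eq0 => /orP[] /eqP e2 e3; apply: (mulIf fi0).
    by rewrite e1 e2 !mul0r.
  by rewrite e3 e2 mulr0 mul0r.
split.
  apply: (main x (b * x - a * y) (b' * x - a' * y) t).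
  - by rewrite -xK -Kj Kjj.
  - by rewrite -xK -Kj Kjk mulr0.
  - by rewrite -xK -Kk Kkk.
apply: (main y (a * y - b * x) (a' * y - b' * x) s).
- by rewrite -yK -Kj Kjj.
- by rewrite -yK -Kj Kjk mulr0.
- by rewrite -yK -Kk Kkk.
Qed.

(** A syzygy [u] satisfies [f i * u = \sum_j u j * koszul i j], which puts every
    [f i * u] in the span of [s] and [t].  The coefficients are proportional to [f]
    because [s] and [t] are independent, and grade two removes the factor [f i]. *)
Lemma koszul_span_syzygies (u : 'I_3 -> A) :
  (forall a, (forall i j, a i * f j = a j * f i) ->
     exists c, forall i, a i = c * f i) ->
  \sum_i u i * f i = 0 -> exists a b, forall l, u l = a * s l + b * t l.
Proof.
move=> grade2 uf.
have uK i l : \sum_j u j * koszul i j l = f i * u l.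
  rewrite /koszul (eq_bigr (fun j => u j * (f i *+ (l == j)) - (u j * f j) *+ (l == i))).
    rewrite sumrB sumrMnl uf mul0rn subr0 (bigD1 l) //= eqxx big1 ?addr0 1?mulrC //.
    by move=> j /negbTE jl; rewrite eq_sym jl mulr0.
  by move=> j _; rewrite mulrBr -[in RHS]mulrnAr.
have span i : exists ab, forall l, f i * u l = ab.1 * s l + ab.2 * t l.
  have Ki j : exists c : A * A, forall l, koszul i j l = c.1 * s l + c.2 * t l.
    by have [a [b ab]] := koszul_span i j; exists (a, b).
  have [c cK] := fin_all_exists Ki.
  exists (\sum_j u j * (c j).1, \sum_j u j * (c j).2) => l /=.
  rewrite -uK !mulr_suml -big_split /=; apply: eq_bigr => j _.
  by rewrite cK mulrDr !mulrA.
have [ab fu] := fin_all_exists span.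
have prop i j : (ab i).1 * f j - (ab j).1 * f i = 0 /\
                (ab i).2 * f j - (ab j).2 * f i = 0.
  apply: koszul_span_free => l.
  transitivity (f j * (f i * u l) - f i * (f j * u l)); last by ring.
  by rewrite !fu; ring.
have [i j|a ea] := grade2 (fun i => (ab i).1); first exact: subr0_eq (prop i j).1.
have [i j|b eb] := grade2 (fun i => (ab i).2); first exact: subr0_eq (prop i j).2.
have [i fi0] := f_neq0; exists a, b => l; apply: (mulfI fi0).
rewrite fu ea eb; ring.
Qed.

End KoszulSpan.

(** * Degrees of syzygies *)

Section Degrees.
Variables (k : fieldType) (n : nat).
Implicit Types (v h : {mpoly k[n]}) (d : nat) (z : int).

Lemma pihomogM_dhomog d e v h : h \is e.-homog ->
  pihomog mdeg d (v * h) = if (e <= d)%N then pihomog mdeg (d - e) v * h else 0.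
Proof.
move=> hh; set N := maxn (mmeasure mdeg v) d.+1.
rewrite [in LHS](@pihomog_partitionE _ _ mdeg N v) ?leq_maxl //.
rewrite mulr_suml raddf_sum /=.
have comp i : pihomog mdeg d (pihomog mdeg i v * h) =
    if (i + e == d)%N then pihomog mdeg i v * h else 0.
  have hM : pihomog mdeg i v * h \is (i + e).-homog.
    by apply: dhomogM => //; apply: pihomogP.
  case: eqP => [<-|/eqP ne]; first by rewrite pihomog_dE.
  by rewrite (pihomog_ne0 _ hM) // eq_sym.
under eq_bigr do rewrite comp.
case: leqP => [ed|de]; last first.
  by rewrite big1 // => i _; case: eqP => // ie; move: de; rewrite -ie ltnNge leq_addl.
have dN : (d - e < N)%N by rewrite leq_max ltnS leq_subr orbT.
rewrite (bigD1 (Ordinal dN)) //= subnK // eqxx big1 ?addr0 // => i ne.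
case: eqP => // ie; case/eqP: ne; apply: val_inj => /=.
by rewrite -ie addnK.
Qed.

(** The part of [v] that contributes to degree [d] in the products of [v] with
    forms of degree [z]. *)
Definition complementary_part d z v : {mpoly k[n]} :=
  if z is Posz e then if (e <= d)%N then pihomog mdeg (d - e) v else 0 else 0.

Lemma pihomogM_form d z v h : is_form z h ->
  pihomog mdeg d (v * h) = complementary_part d z v * h.
Proof.
case: z => [e|e] /=; last by move/eqP ->; rewrite !mulr0 raddf0.
by move/pihomogM_dhomog ->; case: ifP => //; rewrite mul0r.
Qed.

Lemma complementary_part0 d z v : d%:Z < z -> complementary_part d z v = 0.
Proof. by case: z => [e|e] //=; rewrite ltz_nat ltnNge => /negbTE ->. Qed.

End Degrees.

(** * The third generator of the syzygy module *)

(** The rows of [A] are the generators of the syzygy module, [e] their degrees, and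
    [r] is a row other than [s] and [t].  If all rows besides [s] and [t] had degree
    above [d], the Koszul relations, whose entries have degree [d], would lie in the
    span of rows [s] and [t], hence so would row [r]; this gives a relation between
    the rows of [A] with coefficient [1] on row [r], which minimality excludes. *)
Lemma degree_third_generator (k : fieldType) (n d : nat) (J : idealr {mpoly k[n]})
    (n0 n1 n2 : nat) (f : 'cV[{mpoly k[n]}]_n0) (A : 'M_(n1, n0)) (B : 'M_(n2, n1))
    (e : 'I_n1 -> int) (s t r : 'I_n1) :
  n0 = 3%N -> has_height J 2 ->
  (forall p, p \in J <-> exists u : 'rV_n0, p = (u *m f) 0 0) ->
  (forall u : 'rV_n0, u *m f = 0 <-> exists v : 'rV_n1, u = v *m A) ->
  (forall u : 'rV_n1, u *m A = 0 <-> exists v : 'rV_n2, u = v *m B) ->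
  (forall i j, (B i j)@_0%MM = 0) ->
  (forall i, f i 0 \is d.-homog) -> (forall j l, is_form (e j) (A j l)) ->
  s != t -> r != s -> r != t ->
  exists2 j, (j != s) && (j != t) & e j <= d%:Z.
Proof.
move=> n03; subst n0 => ht imf exA exB minB homf homA st rs rt.
apply: NNPP => noj.
have big_e j : j != s -> j != t -> d%:Z < e j.
  by move=> js jt; rewrite ltNge; apply/negP => ej; apply: noj; exists j; rewrite ?js.
pose g i := f i 0.
have genJ : generated_by J g.
  move=> p; rewrite imf; split=> [[u ->]|[c ->]].
    by exists (u 0); rewrite mxE.
  by exists (\row_i c i); rewrite mxE; apply: eq_bigr => i _; rewrite mxE.
have fU := @factorial_mpoly k n.
have rowsf (u : 'I_3 -> {mpoly k[n]}) :
    \sum_i u i * g i = 0 <-> exists v : 'rV_n1, forall l, u l = \sum_j v 0 j * A j l.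
  have -> : (\sum_i u i * g i = 0) <-> (\row_i u i) *m f = 0.
    have -> : \sum_i u i * g i = ((\row_i u i) *m f) 0 0.
      by rewrite mxE; apply: eq_bigr => i _; rewrite mxE.
    split=> [uf|->]; last by rewrite mxE.
    by apply/matrixP => i j; rewrite !ord1 uf mxE.
  rewrite exA; split=> [[v /rowP uv]|[v uv]]; exists v.
    by move=> l; have := uv l; rewrite !mxE.
  by apply/rowP => l; rewrite !mxE uv.
have kos i j : exists a b, forall l, koszul g i j l = a * A s l + b * A t l.
  have [v Kv] : exists v : 'rV_n1, forall l, koszul g i j l = \sum_m v 0 m * A m l.
    apply/rowsf; rewrite /koszul.
    under eq_bigr do rewrite mulrBl !mulrnAl.
    rewrite sumrB (bigD1 j) //= eqxx big1 => [|m /negbTE ->] //.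
    rewrite (bigD1 i) //= eqxx big1 => [|m /negbTE ->] //.
    by rewrite !addr0 mulrC subrr.
  (* In degree d only the rows s and t contribute. *)
  exists (complementary_part d (e s) (v 0 s)), (complementary_part d (e t) (v 0 t)).
  move=> l; rewrite -[LHS](@pihomog_dE _ _ mdeg d); last first.
    by rewrite /koszul rpredB // rpredMn //; apply: homf.
  rewrite Kv raddf_sum /=.
  under eq_bigr do rewrite (pihomogM_form _ _ (homA _ _)).
  rewrite (bigD1 s) // (bigD1 t) 1?eq_sym //= big1 ?addr0 // => m /andP[ms mt].
  by rewrite complementary_part0 ?mul0r // big_e.
have [||a [b rab]] := koszul_span_syzygies (height2_neq0 fU ht genJ) kos (u := A r).
- by move=> c; apply: (height2_grade2 fU ht genJ).
- apply/rowsf; exists (delta_mx 0 r) => l.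
  rewrite (bigD1 r) //= mxE !eqxx mul1r big1 ?addr0 // => j jr.
  by rewrite mxE (negbTE jr) mul0r.
pose u : 'rV_n1 := delta_mx 0 r - a *: delta_mx 0 s - b *: delta_mx 0 t.
have [v /rowP/(_ r)] : exists v : 'rV_n2, u = v *m B.
  apply/exB; rewrite /u !mulmxBl -!scalemxAl -!rowE.
  by apply/rowP => l; rewrite !mxE rab; ring.
rewrite !mxE !eqxx (negbTE rs) (negbTE rt) !mulr0 !subr0.
move=> /(congr1 (mcoeff 0%MM)); rewrite rmorph1 raddf_sum big1 => [/eqP|j _].
  by rewrite oner_eq0.
by rewrite /= rmorphM /= minB mulr0.
Qed.

Theorem theorem2p2
  (k : fieldType) (n : nat) (n_ge3 : (3 <= n)%N)
  (d : nat) (d_ge1 : (1 <= d)%N)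
  (J : idealr {mpoly k[n]})
  (J_homogeneous : homogeneous_ideal J)
  (J_height : has_height J 2)
  (J_nonperfect : ~ perfect J)
  (J_three_forms : exists f : 'I_3 -> {mpoly k[n]},
     (forall i, f i \is d.-homog) /\ generated_by J f)
  (rho : nat) (rho_ge2 : (2 <= rho)%N)
  (J_proj_dim : has_proj_dim (ideal_module J) rho)
  (m : nat) (m_ge3 : (2 < m)%N) (delta : m.-tuple int)
  (delta_sorted : forall i j : 'I_m, (i <= j)%N -> tnth delta i <= tnth delta j)
  (twist : nat -> seq int)
  (aug : 'cV[{mpoly k[n]}]_(size (twist 0%N)))
  (phi : forall i, 'M[{mpoly k[n]}]_(size (twist i.+1), size (twist i)))
  (twist0 : twist 0%N = nseq 3 d%:Z)
  (twist1 : twist 1%N = [seq d%:Z + e | e <- delta])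
  (twist_length : forall i, (rho < i)%N -> twist i = [::])
  (resolution : minimal_graded_free_resolution J aug phi) :
  tnth delta (Ordinal m_ge3) <= d%:Z.
Proof.
have size0 : size (twist 0%N) = 3%N by rewrite twist0 size_nseq.
have size1 : size (twist 1%N) = m by rewrite twist1 size_map size_tuple.
have nth0 (j : 'I_(size (twist 0%N))) : (twist 0%N)`_j = d%:Z.
  by rewrite {1}twist0 nth_nseq -size0 ltn_ord.
have nth1 (j : 'I_(size (twist 1%N))) :
    (twist 1%N)`_j = d%:Z + tnth delta (cast_ord size1 j).
  by rewrite {1}twist1 (nth_map 0) ?size_tuple -?size1 // (tnth_nth 0).
have [augF phiF augI ex0 ex1 minphi] := resolution.
have lt1 i : (i <= 2)%N -> (i < size (twist 1%N))%N.
  by move=> i2; rewrite size1; apply: leq_ltn_trans m_ge3.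
have [i|j l||||j /andP[j0 j1] dj] :=
    degree_third_generator (d := d) (e := fun j => tnth delta (cast_ord size1 j))
      (s := Ordinal (lt1 0%N isT)) (t := Ordinal (lt1 1%N isT))
      (r := Ordinal (lt1 2%N isT)) size0 J_height augI ex0 (ex1 0%N) (minphi 1%N).
- by have := augF i; rewrite nth0.
- by have := phiF 0%N j l; rewrite nth0 nth1 addrAC subrr add0r.
- by [].
- by [].
- by [].
apply: le_trans dj; apply: delta_sorted => /=.
by case: j j0 j1 => [[|[|j]] jlt].
Qed.
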